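(* Let $P$ be a finite bounded poset with an interpolating EL-labelling. Then the unique increasing chain from $\hat{0}$ to $\hat{1}$ is a left modular maximal chain of $P$.
   Context: A poset is bounded if it has a unique minimum $\hat 0$ and a unique maximum $\hat 1$. An edge-labelling of $P$ is a map $\gamma$ from the covering relations $y\lessdot z$ of $P$ to $\mathbb{Z}$. It is an EL-labelling if for every $y<z$: (i) there is a unique unrefinable chain $y=w_0\lessdot\cdots\lessdot w_r=z$ with weakly increasing labels (the increasing chain from $y$ to $z$), and (ii) its label sequence lexicographically precedes that of every other unrefinable chain from $y$ to $z$. It is interpolating if for every $y\lessdot u\lessdot z$, either $\gamma(y,u)<\gamma(u,z)$, or the increasing chain $y=w_0\lessdot\cdots\lessdot w_r=z$ has strictly increasing labels with $\gamma(w_0,w_1)=\gamma(u,z)$ and $\gamma(w_{r-1},w_r)=\gamma(y,u)$. $x\vee y$, $x\wedge y$ denote least common upper bound / greatest common lower bound when they exist. For $w,z\ge y$, $w\wedge_y z$ is the greatest element of $\{u: y\le u\le w,\ u\le z\}$ if it exists; for $w,y\le z$, $w\vee^z y$ is the least element of $\{u: w\le u,\ y\le u,\ u\le z\}$ if it exists. An element $x$ is viable if for all $y\le z$ both $(x\vee y)\wedge_y z$ and $(x\wedge z)\vee^z y$ exist; a viable $x$ is left modular if $(x\vee y)\wedge_y z=(x\wedge z)\vee^z y$ for all $y\le z$. A maximal chain is left modular if each of its elements is viable and left modular. *)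

(* Defs.v *)
From mathcomp Require Import all_boot all_order all_algebra.

Set Implicit Arguments.
Unset Strict Implicit.
Unset Printing Implicit Defensive.

Local Open Scope order_scope.

Section Posets.

Context {d : Order.disp_t} {T : finPOrderType d}.
Implicit Types (x y z u v w m : T) (s t : seq T) (A : {set T}).

Definition covers y z : bool := (y < z) && [forall u, ~~ (y < u < z)].

Definition is_greatest A m : Prop := m \in A /\ forall u, u \in A -> u <= m.
Definition is_least A m : Prop := m \in A /\ forall u, u \in A -> m <= u.

Definition is_join x y m : Prop := is_least [set u | (x <= u) && (y <= u)] m.
Definition is_meet x y m : Prop :=
  is_greatest [set u | (u <= x) && (u <= y)] m.

(* m is the meet of w and z relative to the lower bound y, for y <= w, z. *)
Definition is_meet_above y w z m : Prop :=
  is_greatest [set u | [&& y <= u, u <= w & u <= z]] m.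

(* m is the join of w and y relative to the upper bound z, for w, y <= z. *)
Definition is_join_below z w y m : Prop :=
  is_least [set u | [&& w <= u, y <= u & u <= z]] m.

(* is_join_meet x y z m : m is (x \/ y) /\_y z, all of it being defined;
   is_meet_join x y z m : m is (x /\ z) \/^z y, all of it being defined. *)
Definition is_join_meet x y z m : Prop :=
  exists2 v, is_join x y v & is_meet_above y v z m.
Definition is_meet_join x y z m : Prop :=
  exists2 v, is_meet x z v & is_join_below z v y m.

Definition viable x : Prop :=
  forall y z, y <= z ->
    (exists m, is_join_meet x y z m) /\ (exists m, is_meet_join x y z m).

Definition left_modular x : Prop :=
  viable x /\
  forall y z, y <= z ->
    forall m m', is_join_meet x y z m -> is_meet_join x y z m' -> m = m'.

Definition is_chain A : bool :=
  [forall x in A, forall y in A, x >=< y].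

Definition left_modular_maximal_chain A : Prop :=
  maxset is_chain A /\ forall x, x \in A -> left_modular x.

(* The chain y = w_0 < w_1 < ... < w_r = z is encoded as y together with the
   sequence s = [:: w_1; ...; w_r], as usual for path. *)
Definition unrefinable_chain y z s : bool := path covers y s && (last y s == z).

Section Labelling.

(* Only the values of gamma on covering relations are ever used, so that gamma
   stands for a map from the covering relations to the integers. *)
Variable gamma : T -> T -> int.

Definition labels y s : seq int := pairmap gamma y s.

Definition increasing_chain y z s : bool :=
  unrefinable_chain y z s && sorted <=%O (labels y s).

Definition EL_labelling : Prop :=
  forall y z, y < z ->
    exists s, unique (increasing_chain y z) s /\
      forall t, unrefinable_chain y z t -> t != s ->
        (labels y s : seqlexi int) < (labels y t : seqlexi int).

Definition interpolating : Prop :=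
  forall y u z, covers y u -> covers u z ->
    gamma y u < gamma u z \/
    exists s, [/\ increasing_chain y z s,
                  sorted <%O (labels y s),
                  head 0%R (labels y s) = gamma u z
                & last 0%R (labels y s) = gamma y u].

End Labelling.

End Posets.

(* Main.v *)
(** The increasing chain between two elements is reached from any unrefinable
    chain by replacing non-ascents with increasing chains; by interpolation,
    the labels of a chain are therefore all found on the increasing chain with
    the same ends, and those in turn lie between labels of the given chain.
    Fix a down-closed set [D] of labels.  Every interval [[a, b]] then has a
    unique element [p], its split point, such that the labels inside [[a, p]]
    are all in [D] and the labels inside [[p, b]] are all outside [D].
    If [x] is the split point of [[0, 1]], then [x \/ y] and [x /\ z] are
    the split points of [[y, 1]] and [[0, z]], and both sides of the left
    modularity equation for [y <= z] are the split point of [[y, z]].  Since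
    increasing chains turn out to be strictly increasing, each element of the
    increasing chain from [0] to [1] is the split point of [[0, 1]] for
    some [D]. *)
Require Import Defs.
From mathcomp Require Import all_boot all_order all_algebra.

Set Implicit Arguments.
Unset Strict Implicit.
Unset Printing Implicit Defensive.

Import Order.TTheory.
Local Open Scope order_scope.

(** * Covers and unrefinable chains *)

Section Chains.

Context {d : Order.disp_t} {T : finPOrderType d}.
Implicit Types (x y z u v a b p : T) (s t : seq T).

Lemma covers_lt y z : covers y z -> y < z.
Proof. by case/andP. Qed.

Lemma covers_between y z u : covers y z -> y <= u -> u < z -> u = y.
Proof.
move=> /andP[_ /forallP/(_ u)] nyuz yu uz; apply/eqP.
by move: nyuz; rewrite uz andbT lt_neqAle yu andbT negbK eq_sym.
Qed.

Lemma unrefinable_chain_le y z s : unrefinable_chain y z s -> y <= z.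
Proof.
case/andP=> + /eqP <-; elim: s y => //= u s IHs y /andP[/covers_lt yu pus].
exact: le_trans (ltW yu) (IHs _ pus).
Qed.

Lemma unrefinable_chain_cat y u z s t :
  unrefinable_chain y u s -> unrefinable_chain u z t ->
  unrefinable_chain y z (s ++ t).
Proof.
move=> /andP[ps /eqP ls] /andP[pt lt].
by rewrite /unrefinable_chain cat_path last_cat ps ls pt.
Qed.

Lemma unrefinable_chain_nil y s : unrefinable_chain y y s -> s = [::].
Proof.
case: s => // u s; rewrite /unrefinable_chain /= -andbA => /and3P[yu ps ls].
have uy : u <= y by apply: (@unrefinable_chain_le _ _ s); apply/andP.
by have := lt_le_trans (covers_lt yu) uy; rewrite ltxx.
Qed.

(** Climb the chain while staying below [x]. At the last element below [x], either this is the top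
    and equals [x], or [x] is strictly below the next element and the cover leaves no room. This
    gives the maximality of chains. *)
Lemma comparable_mem_chain y z s x :
  unrefinable_chain y z s -> y <= x -> x <= z ->
  {in s, forall u, x >=< u} -> x \in y :: s.
Proof.
case/andP=> + /eqP <-; elim: s y => [|u s IHs] y /=.
  by move=> _ yx xy _; rewrite inE eq_le xy yx.
move=> /andP[yu ps] yx xl cmp; rewrite inE.
have [ux|nux] := boolP (u <= x).
  rewrite (IHs u) ?orbT // => v vs; apply: cmp.
  by rewrite inE vs orbT.
have xu : x < u.
  by have := cmp u (mem_head _ _); case: (comparableP x u) nux.
by rewrite (covers_between yu yx xu) eqxx.
Qed.

Section Labelling.

Variable gamma : T -> T -> int.

Lemma labels_cat y s t :
  labels gamma y (s ++ t) = labels gamma y s ++ labels gamma (last y s) t.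
Proof. exact: pairmap_cat. Qed.

Lemma size_labels y s : size (labels gamma y s) = size s.
Proof. exact: size_pairmap. Qed.

(** Cut just before the first label outside [D]: later labels are at least as large, so they stay
    outside. *)
Lemma increasing_chain_split (D : pred int) y z s :
    (forall k l, k <= l -> D l -> D k) ->
    increasing_chain gamma y z s ->
  exists p s1 s2,
    [/\ unrefinable_chain y p s1, unrefinable_chain p z s2,
        all D (labels gamma y s1) & all (predC D) (labels gamma p s2)].
Proof.
move=> downD; elim: s y => [|u s IHs] y /andP[/andP[ps ls] srt].
  by exists y, [::], [::]; split=> //; apply/andP.
move: ps => /= /andP[yu ps].
have [Du|nDu] := boolP (D (gamma y u)).
  case: (IHs u) => [|p [s1 [s2 [c1 c2 D1 D2]]]].
    by rewrite /increasing_chain /unrefinable_chain ps ls (path_sorted srt).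
  exists p, (u :: s1), s2; split=> //=; last by rewrite Du.
  by move: c1; rewrite /unrefinable_chain /= yu.
exists y, [::], (u :: s); split=> //=.
- by rewrite /unrefinable_chain /= eqxx.
- by rewrite /unrefinable_chain /= yu ps.
rewrite nDu; apply/allP=> l lin; apply: contra nDu; apply: downD.
by have /allP/(_ l lin) := order_path_min le_trans srt.
Qed.

(** * Increasing chains under an interpolating labelling *)

Section Interpolating.

Hypotheses (hEL : EL_labelling gamma) (hint : interpolating gamma).

Lemma unique_increasing_chain y z :
  y <= z -> exists s, unique (increasing_chain gamma y z) s.
Proof.
rewrite le_eqVlt => /predU1P[<-|/hEL[s [us _]]]; last by exists s.
(* [EL_labelling] speaks of [y < z] only; for [y = z] the empty chain is the only one. *)
exists [::]; split; first by rewrite /increasing_chain /unrefinable_chain /= eqxx.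
by move=> t /andP[/unrefinable_chain_nil].
Qed.

Lemma increasing_chain_inj y z s t :
  increasing_chain gamma y z s -> increasing_chain gamma y z t -> s = t.
Proof.
move=> cs ct; have yz : y <= z by case/andP: cs => /unrefinable_chain_le.
by have [r [_ ur]] := unique_increasing_chain yz; rewrite -(ur s) // (ur t).
Qed.

(** With equal labels, [[:: u; z]] would be the increasing chain, which interpolation forces to be
    strict. *)
Lemma consecutive_labels_neq y u z :
  covers y u -> covers u z -> gamma y u != gamma u z.
Proof.
move=> yu uz; apply/eqP=> eq_l.
case: (hint yu uz) => [|[s [cs srt _ _]]]; first by rewrite eq_l ltxx.
have cuz : increasing_chain gamma y z [:: u; z].
  by rewrite /increasing_chain /unrefinable_chain /= yu uz eqxx eq_l lexx.
by move: srt; rewrite (increasing_chain_inj cs cuz) /= eq_l ltxx.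
Qed.

Lemma increasing_chain_strict y z s :
  increasing_chain gamma y z s -> sorted <%O (labels gamma y s).
Proof.
case/andP=> /andP[+ _]; elim: s y => // u [|v s] // IHs y.
move=> /= /and3P[yu uv ps] /andP[le1 srt].
rewrite lt_neqAle le1 (consecutive_labels_neq yu uv) /=.
by apply: IHs; rewrite /= ?uv.
Qed.

(* Bubble sort from the end: once the tail is increasing, a non-ascent at the
   bottom is replaced by an increasing chain with a smaller first label. *)
Lemma increasing_chain_labels y z t :
    unrefinable_chain y z t ->
  exists s, [/\ increasing_chain gamma y z s,
    {subset labels gamma y t <= labels gamma y s} &
    forall D : pred int, (forall j k l, j <= k <= l -> D j -> D l -> D k) ->
      all D (labels gamma y t) -> all D (labels gamma y s)].
Proof.
(* The outer induction counts the elements above [y], so it covers every chain to [z] that starts at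
   a cover of [y]. *)
have [n] := ubnP #|[set v | y < v]|; elim: n y t => // n IHn y [|u0 t]; rewrite ltnS => le_n.
  by exists [::]; split=> //; apply/andP.
rewrite /unrefinable_chain /= -andbA => /and3P[yu0 pt lt].
have tail_le v : covers y v -> (#|[set w | (v < w)%O]| < n)%N.
  move=> /covers_lt yv; apply: leq_trans le_n; apply: proper_card.
  apply/properP; split; last by exists v; rewrite inE ?ltxx.
  by apply/subsetP=> w; rewrite !inE; apply: lt_trans.
have [s1 [c1 sub1 D1]] := IHn u0 t (tail_le _ yu0) (introT andP (conj pt lt)).
suff [s [cs subs Ds]] : exists s, [/\ increasing_chain gamma y z s,
    {subset labels gamma y (u0 :: s1) <= labels gamma y s} &
    forall D : pred int, (forall j k l, j <= k <= l -> D j -> D l -> D k) ->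
      all D (labels gamma y (u0 :: s1)) -> all D (labels gamma y s)].
  exists s; split=> // [l|D cvxD /= /andP[Du Dt]].
    rewrite inE => /predU1P[->|/sub1 l1]; apply: subs; first exact: mem_head.
    by rewrite inE l1 orbT.
  by apply: Ds => //=; rewrite Du D1.
clear t pt lt sub1 D1; move: u0 yu0 s1 c1 => u.
(* The inner induction makes the first label decrease: the replacement of a descent starts with the
   smaller label [gamma u u2]. *)
have [m] := ubnP #|[set v | gamma y v < gamma y u]|.
elim: m u => // m IHm u; rewrite ltnS => le_m yu s1 /andP[/andP[p1 l1] srt1].
have [srt|nsrt] := boolP (sorted <=%O (labels gamma y (u :: s1))).
  exists (u :: s1); split=> //.
  by rewrite /increasing_chain /unrefinable_chain /= yu p1 l1.
case: s1 p1 l1 srt1 nsrt => // u2 s2 /= /andP[uu2 p2] l2 srt2.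
rewrite srt2 andbT -ltNge => lt_u.
case: (hint yu uu2) => [/(lt_trans lt_u)|]; first by rewrite ltxx.
case=> -[|v t] [ct _ /= hd_t last_t].
  case/andP: ct => /andP[_ /eqP /= eq_yu2] _.
  have := lt_trans (covers_lt yu) (covers_lt uu2).
  by rewrite eq_yu2 ltxx.
case/andP: ct => /andP[/= /andP[yv pvt] /eqP lvt] srt_t.
have [s3 [c3 sub3 D3]] : exists s, [/\ increasing_chain gamma v z s,
    {subset labels gamma v (t ++ s2) <= labels gamma v s} &
    forall D : pred int, (forall j k l, j <= k <= l -> D j -> D l -> D k) ->
      all D (labels gamma v (t ++ s2)) -> all D (labels gamma v s)].
  apply: IHn (tail_le _ yv) _; apply: (@unrefinable_chain_cat _ u2).
    by rewrite /unrefinable_chain pvt lvt eqxx.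
  by rewrite /unrefinable_chain p2 l2.
have [|s [cs subs Ds]] := IHm v _ yv s3 c3.
  apply: leq_trans le_m; apply: proper_card.
  apply/properP; split; last by exists v; rewrite inE ?ltxx ?hd_t.
  by apply/subsetP=> w; rewrite !inE hd_t => /lt_trans; apply.
have sub_vt l : l \in labels gamma y (v :: t) ++ labels gamma u2 s2 ->
    l \in labels gamma y s.
  rewrite -lvt -labels_cat /= inE => /predU1P[->|/sub3 l3]; apply: subs.
    exact: mem_head.
  by rewrite inE l3 orbT.
exists s; split=> // [l|D cvxD /and3P[Du Du2 D2]].
  rewrite !inE => /or3P[/eqP->|/eqP->|l_s2]; apply: sub_vt; rewrite mem_cat.
  - by rewrite -last_t mem_last.
  - by rewrite -hd_t mem_head.
  by rewrite l_s2 orbT.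
apply: Ds => //=; have Dvt : all D (labels gamma y (v :: t)).
  (* The labels of the replacing chain lie between its first and last ones, which are the two labels
     of the descent. *)
  apply/allP=> l lin; apply: (cvxD (gamma u u2) l (gamma y u)) => //.
  have sorted_nth i j : (i <= j < size (labels gamma y (v :: t)))%N ->
      nth 0%R (labels gamma y (v :: t)) i <= nth 0%R (labels gamma y (v :: t)) j.
    case/andP=> ij jn; apply: (sorted_leq_nth le_trans lexx) => //.
    exact: leq_ltn_trans ij jn.
  have i_lt := lin; rewrite -index_mem in i_lt.
  rewrite -(nth_index 0%R lin) -last_t -hd_t.
  apply/andP; split; first exact: (sorted_nth 0%N).
  rewrite -[last _ _](nth_last 0%R (labels gamma y (v :: t))).
  by apply: sorted_nth; rewrite /= ltnS leqnn andbT -ltnS.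
have /andP[Dv Dt] : D (gamma y v) && all D (labels gamma v t) := Dvt.
rewrite Dv D3 // labels_cat all_cat Dt.
by rewrite lvt.
Qed.

(** * Labels occurring inside an interval *)

Definition interval_labels (D : pred int) a b : Prop :=
  forall u v, a <= u -> covers u v -> v <= b -> D (gamma u v).

(** One chain tests the whole interval. Any cover in it extends to a chain from [a] to [b], so its
    label occurs on the increasing chain, whose labels are in [D] by convexity. *)
Lemma interval_labelsP (D : pred int) a b s :
    (forall j k l, j <= k <= l -> D j -> D l -> D k) ->
    unrefinable_chain a b s ->
  interval_labels D a b <-> all D (labels gamma a s).
Proof.
move=> cvxD cs; split=> [Dab|Ds u v au uv vb].
  case/andP: cs Dab => + /eqP <-; elim: s {b} a => //= u s IHs a.
  move=> /andP[au ps] Dab; have us : unrefinable_chain u (last u s) s.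
    by rewrite /unrefinable_chain ps eqxx.
  rewrite Dab ?(unrefinable_chain_le us) // IHs // => x y ux xy yl.
  by apply: Dab => //; exact: le_trans (ltW (covers_lt au)) ux.
have [s' [cs' _ /(_ D cvxD Ds) Ds']] := increasing_chain_labels cs.
have [s1 [/andP[c1 _] _]] := unique_increasing_chain au.
have [s2 [/andP[c2 _] _]] := unique_increasing_chain vb.
have c2v : unrefinable_chain u b (v :: s2).
  by move: c2; rewrite /unrefinable_chain /= uv.
have [t [ct subt _]] := increasing_chain_labels (unrefinable_chain_cat c1 c2v).
move: subt; rewrite (increasing_chain_inj ct cs') => subs'.
apply: (allP Ds'); apply: subs'; case/andP: c1 => _ /eqP l1.
by rewrite labels_cat l1 mem_cat inE eqxx orbT.
Qed.

Lemma interval_labels_sub (D : pred int) a b u v :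
  a <= u -> v <= b -> interval_labels D a b -> interval_labels D u v.
Proof.
move=> au vb Dab x y ux xy yv; apply: Dab => //; first exact: le_trans ux.
exact: le_trans vb.
Qed.

(** A cover inside [[a, c]] may avoid both halves, but testing a single chain through [b]
    suffices. *)
Lemma interval_labels_trans (D : pred int) a b c :
    (forall j k l, j <= k <= l -> D j -> D l -> D k) ->
    a <= b -> b <= c ->
  interval_labels D a b -> interval_labels D b c -> interval_labels D a c.
Proof.
move=> cvxD ab bc.
have [s [/andP[cs _] _]] := unique_increasing_chain ab.
have [t [/andP[ct _] _]] := unique_increasing_chain bc.
move=> /(interval_labelsP cvxD cs) Ds /(interval_labelsP cvxD ct) Dt.
apply/(interval_labelsP cvxD (unrefinable_chain_cat cs ct)).
by case/andP: cs => _ /eqP ls; rewrite labels_cat all_cat Ds ls.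
Qed.

(** * Split points of intervals *)

Section Split.

Variable D : pred int.
Hypothesis downD : forall k l, k <= l -> D l -> D k.

Let cvxD j k l : j <= k <= l -> D j -> D l -> D k.
Proof. by case/andP=> _ kl _; apply: downD. Qed.

Let cvxDC j k l : j <= k <= l -> predC D j -> predC D l -> predC D k.
Proof. by case/andP=> jk _ /= nDj _; apply: contra nDj; apply: downD. Qed.

Definition split_point a b p : Prop :=
  [/\ a <= p, p <= b, interval_labels D a p & interval_labels (predC D) p b].

Lemma split_pointP a b p s t :
    unrefinable_chain a p s -> unrefinable_chain p b t ->
  all D (labels gamma a s) -> all (predC D) (labels gamma p t) ->
  split_point a b p.
Proof.
move=> cs ct Ds Dt; split; [exact: unrefinable_chain_le cs|
  exact: unrefinable_chain_le ct| exact/(interval_labelsP cvxD cs)|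
  exact/(interval_labelsP cvxDC ct)].
Qed.

Lemma split_point_exists a b : a <= b -> exists p, split_point a b p.
Proof.
move=> /unique_increasing_chain[s [cs _]].
have [p [s1 [s2 [c1 c2 D1 D2]]]] := increasing_chain_split downD cs.
by exists p; apply: split_pointP c1 c2 D1 D2.
Qed.

(** The increasing chains on the two sides of a split point concatenate to the increasing chain from
    [a] to [b], and the split point is where its labels leave [D]. *)
Lemma split_point_inj a b p q : split_point a b p -> split_point a b q -> p = q.
Proof.
have chains r : split_point a b r -> exists s t,
    [/\ last a s = r, increasing_chain gamma a b (s ++ t),
        all D (labels gamma a s) & all (predC D) (labels gamma r t)].
  case=> ar rb Dar Drb.
  have [s [/andP[cs srs] _]] := unique_increasing_chain ar.
  have [t [/andP[ct srt] _]] := unique_increasing_chain rb.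
  have Ds := (interval_labelsP cvxD cs).1 Dar.
  have Dt := (interval_labelsP cvxDC ct).1 Drb.
  have /eqP ls : last a s == r by case/andP: cs.
  exists s, t; split=> //; rewrite /increasing_chain (unrefinable_chain_cat cs ct).
  move: srs srt; rewrite labels_cat ls !(sorted_pairwise le_trans) pairwise_cat.
  move=> -> ->; rewrite !andbT; apply/allrelP=> k l /(allP Ds) Dk /(allP Dt).
  by move=> /= nDl; rewrite leNgt; apply: contra nDl => /ltW/downD; apply.
move=> /chains[s [t [<- cst Ds Dt]]] /chains[s' [t' [<- cst' Ds' Dt']]].
(* The number of labels in [D] on the common chain determines the length of the lower part. *)
suff count_size r w : all D (labels gamma a r) ->
    all (predC D) (labels gamma (last a r) w) ->
    count D (labels gamma a (r ++ w)) = size r.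
  have eq_st := increasing_chain_inj cst cst'.
  have /eqP := eq_st; rewrite eqseq_cat ?(count_size _ _ Ds Dt) //.
    by case/andP=> /eqP->.
  by rewrite -(count_size s t) // eq_st count_size.
rewrite labels_cat count_cat all_count size_labels => /eqP->.
by rewrite all_predC has_count -eqn0Ngt => /eqP->; rewrite addn0.
Qed.

Lemma split_point_extend_right a b c p :
  split_point a b p -> b <= c -> interval_labels (predC D) b c ->
  split_point a c p.
Proof.
move=> [ap pb Dap Dpb] bc Dbc; split=> //; first exact: le_trans bc.
exact: interval_labels_trans Dpb Dbc.
Qed.

Lemma split_point_extend_left a b c p :
  split_point b c p -> a <= b -> interval_labels D a b -> split_point a c p.
Proof.
move=> [bp pc Dbp Dpc] ab Dab; split=> //; first exact: le_trans bp.
exact: interval_labels_trans Dab Dbp.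
Qed.

(** The split point does not move when labels in [D] are added at the bottom. So [q] also splits
    [[r, b]], whence [r <= q]; and for [y <= u <= q] with [u <= z], [r] also splits [[u, z]], whence
    [u <= r]. *)
Lemma split_point_meet_above y z b q r :
    split_point y b q -> split_point y z r -> z <= b ->
  is_meet_above y q z r.
Proof.
move=> yb_q yz_r zb; have [yr rz Dyr _] := yz_r; split.
  rewrite inE yr rz andbT /=.
  have [q' rb_q'] := split_point_exists (le_trans rz zb).
  rewrite (split_point_inj yb_q (split_point_extend_left rb_q' yr Dyr)).
  by case: rb_q'.
move=> u; rewrite inE => /and3P[yu uq uz].
have Dyu : interval_labels D y u.
  by case: yb_q => _ _ Dyq _; apply: interval_labels_sub Dyq.
have [r' uz_r'] := split_point_exists uz.
rewrite (split_point_inj yz_r (split_point_extend_left uz_r' yu Dyu)).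
by case: uz_r'.
Qed.

(** Dually, labels outside [D] added at the top leave the split point in place. *)
Lemma split_point_join_below y z a q r :
    split_point a z q -> split_point y z r -> a <= y ->
  is_join_below z q y r.
Proof.
move=> az_q yz_r ay; have [yr rz _ Drz] := yz_r; split.
  rewrite inE yr rz !andbT.
  have [q' ar_q'] := split_point_exists (le_trans ay yr).
  rewrite (split_point_inj az_q (split_point_extend_right ar_q' rz Drz)).
  by case: ar_q'.
move=> u; rewrite inE => /and3P[qu yu uz].
have Duz : interval_labels (predC D) u z.
  by case: az_q => _ _ _; apply: interval_labels_sub.
have [r' yu_r'] := split_point_exists yu.
rewrite (split_point_inj yz_r (split_point_extend_right yu_r' uz Duz)).
by case: yu_r'.
Qed.

End Split.

End Interpolating.

End Labelling.

End Chains.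

Lemma is_greatest_inj (d : Order.disp_t) (T : finPOrderType d) (A : {set T})
  (m m' : T) : is_greatest A m -> is_greatest A m' -> m = m'.
Proof.
by move=> [Am lem] [Am' lem']; apply/le_anti; rewrite lem' ?lem.
Qed.

Lemma is_least_inj (d : Order.disp_t) (T : finPOrderType d) (A : {set T})
  (m m' : T) : is_least A m -> is_least A m' -> m = m'.
Proof.
by move=> [Am lem] [Am' lem']; apply/le_anti; rewrite lem ?lem'.
Qed.

(** * Left modularity and maximality in the bounded poset *)

Section Bounded.

Context {d : Order.disp_t} {P : finTBPOrderType d}.
Variable gamma : P -> P -> int.
Hypotheses (hEL : EL_labelling gamma) (hint : interpolating gamma).

Section Split.

Variables (D : pred int) (x : P).
Hypotheses (downD : forall k l, k <= l -> D l -> D k)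
  (split_x : split_point gamma D \bot \top x).

(* Within the bounded poset, a join is a join below [\top], and a meet is a
   meet above [\bot]. *)
Lemma split_point_join y q : split_point gamma D y \top q -> is_join x y q.
Proof.
move=> y1_q; rewrite /is_join.
have := split_point_join_below hEL hint downD split_x y1_q (le0x y).
by congr is_least; apply/setP=> u; rewrite !inE lex1 andbT.
Qed.

Lemma split_point_meet z q : split_point gamma D \bot z q -> is_meet x z q.
Proof.
move=> z0_q; rewrite /is_meet.
have := split_point_meet_above hEL hint downD split_x z0_q (lex1 z).
by congr is_greatest; apply/setP=> u; rewrite !inE le0x.
Qed.

Lemma split_point_left_modular : left_modular x.
Proof.
have split y z : y <= z -> exists r, [/\ split_point gamma D y z r,
    is_join_meet x y z r & is_meet_join x y z r].
  move=> yz; have [r yz_r] := split_point_exists hEL hint downD yz.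
  have [v y1_v] := split_point_exists hEL hint downD (lex1 y).
  have [w z0_w] := split_point_exists hEL hint downD (le0x z).
  exists r; split=> //.
    exists v; first exact: split_point_join.
    exact: (split_point_meet_above hEL hint downD y1_v yz_r (lex1 z)).
  exists w; first exact: split_point_meet.
  exact: (split_point_join_below hEL hint downD z0_w yz_r (le0x y)).
split=> y z /split[r [_ [v jv mr] [w mw jr]]].
  by split; exists r; [exists v|exists w].
move=> m m' [v' jv' mm] [w' mw' jm'].
rewrite (is_least_inj jv' jv) in mm; rewrite (is_greatest_inj mw' mw) in jm'.
by rewrite (is_greatest_inj mm mr) (is_least_inj jm' jr).
Qed.

End Split.

Lemma increasing_chain_left_modular s x :
  increasing_chain gamma \bot \top s -> x \in \bot :: s -> left_modular x.
Proof.
move=> cs xs; have := increasing_chain_strict hEL hint cs.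
case/splitPl: s / xs cs => s1 s2 <- /andP[/andP[]] {x}.
rewrite cat_path last_cat labels_cat => /andP[p1 p2] l2 _.
rewrite (sorted_pairwise lt_trans) pairwise_cat => /andP[/allrelP lt12 _].
(* The down-closure of the labels below [x]; strictness keeps the labels above [x] out of it. *)
set D : pred int := fun l => has (>= l) (labels gamma \bot s1).
have downD k l : k <= l -> D l -> D k.
  by move=> kl /hasP[m ms lm]; apply/hasP; exists m => //; apply: le_trans lm.
apply: (@split_point_left_modular D) => //.
apply: (split_pointP hEL hint downD (s := s1) (t := s2)).
- by rewrite /unrefinable_chain p1 eqxx.
- by rewrite /unrefinable_chain p2.
- by apply/allP=> l l1; apply/hasP; exists l => /=.
apply/allP=> l ls2; apply/hasPn=> m ms1 /=.
by rewrite -ltNge lt12.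
Qed.

Lemma unrefinable_chain_maximal s :
  unrefinable_chain \bot \top s -> maxset is_chain [set x in (\bot : P) :: s].
Proof.
move=> cs; apply/maxsetP; split=> [|B chB subB].
  have srt : sorted <=%O ((\bot : P) :: s).
    by case/andP: cs => + _; apply: sub_path => y z /covers_lt/ltW.
  apply/'forall_implyP=> x; rewrite inE => xs.
  apply/'forall_implyP=> y; rewrite inE => ys.
  rewrite -(nth_index x xs) -(nth_index x ys).
  have mono := sorted_leq_nth le_trans lexx x srt.
  apply/orP; case/orP: (leq_total (index x (\bot :: s)) (index y (\bot :: s))).
    by move=> /mono h; left; apply: h; rewrite inE index_mem.
  by move=> /mono h; right; apply: h; rewrite inE index_mem.
apply/eqP; rewrite eqEsubset subB andbT; apply/subsetP=> x xB.
rewrite inE; apply: (comparable_mem_chain cs) (le0x x) (lex1 x) _ => u us.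
have uB : u \in B by apply: (subsetP subB); rewrite !inE us orbT.
by have /'forall_implyP/(_ x xB)/'forall_implyP/(_ u uB) := chB.
Qed.

End Bounded.

Theorem theorem3 (d : Order.disp_t) (P : finTBPOrderType d)
    (gamma : P -> P -> int)
    (hEL : EL_labelling gamma) (hint : interpolating gamma) :
  exists s : seq P,
    unique (increasing_chain gamma (\bot : P)%O (\top : P)%O) s /\
    left_modular_maximal_chain [set x in (\bot : P)%O :: s].
Proof.
have [s us] := unique_increasing_chain hEL (le0x (\top : P)).
exists s; split=> //; have [cs _] := us; split.
  by case/andP: cs => /unrefinable_chain_maximal.
by move=> x; rewrite inE; apply: increasing_chain_left_modular cs.
Qed.
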